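(* Let $\mathcal{V}=(V,(f^\sharp)_{f\in E},(\mathfrak{g}^{\mathcal{V}})_{\mathfrak{g}\in F})$ be a locally Laver-like partially endomorphic algebra, where each $f\in E\cup F$ has an arity $n_f$, each $f^\sharp$ ($f\in E$) is an $(n_f+1)$-ary operation, and each $\mathfrak{g}^{\mathcal{V}}$ ($\mathfrak{g}\in F$) is an $n_{\mathfrak{g}}$-ary operation. Let $X$ be a set and let $v_x\in V$ for each $x\in X$. Let $f_x$ be a function symbol of arity $n_f$ for $f\in E,x\in X$, and let $\mathcal{G}=\{f_x\mid f\in E,x\in X\}\cup F$. Define $L\subseteq\mathbf{T}_{\mathcal{G}}(X)$ and $\phi:L\to V$ by recursion on terms: (i) $x\in L$ and $\phi(x)=v_x$ for $x\in X$; (ii) $\mathfrak{g}(\ell_1,\dots,\ell_n)\in L$ iff $\ell_1,\dots,\ell_n\in L$, and then $\phi(\mathfrak{g}(\ell_1,\dots,\ell_n))=\mathfrak{g}^{\mathcal{V}}(\phi(\ell_1),\dots,\phi(\ell_n))$, for $\mathfrak{g}\in F$; (iii) $f_x(\ell_1,\dots,\ell_n)\in L$ iff $\ell_1,\dots,\ell_n\in L$ and $(f,\phi(\ell_1),\dots,\phi(\ell_n))\notin\mathrm{Li}(\Gamma(V,(f^\sharp)_{f\in E}))$, and then $\phi(f_x(\ell_1,\dots,\ell_n))=f^\sharp(\phi(\ell_1),\dots,\phi(\ell_n),v_x)$, for $f\in E$, $x\in X$. Then (1) the set $L$ is locally operable; (2) the mapping $\phi$ is a homomorphism from $(L,(f^\sharp)_{f\in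 E},(\mathfrak{g})_{\mathfrak{g}\in F})$ to $\mathcal{V}$; (3) the algebra $(L,(f^\sharp)_{f\in E},(\mathfrak{g})_{\mathfrak{g}\in F})$ is a partially endomorphic Laver table; (4) if $\mathcal{V}$ is a Laver-like partially endomorphic algebra, then $L$ is operable.
   Context: Partially endomorphic algebra of type $(E,F)$: an algebra in which, for each $f\in E$ (with $(n_f+1)$-ary operation $f^\sharp$) and all $a_1,\dots,a_{n_f}$, the map $x\mapsto f^\sharp(a_1,\dots,a_{n_f},x)$ is an endomorphism of the whole algebra (with respect to all operations from $E$ and $F$). Hull: $\Gamma(V,(f^\sharp)_{f\in E})$ has underlying set $\bigcup_{f\in E}\{f\}\times V^{n_f}$ and operation $(s,x_1,\dots,x_{n_s})*(t,y_1,\dots,y_{n_t})=(t,s^\sharp(x_1,\dots,x_{n_s},y_1),\dots,s^\sharp(x_1,\dots,x_{n_s},y_{n_t}))$; it is an LD-system ($x*(y*z)=(x*y)*(x*z)$). For an LD-system $Z$, $\mathrm{Li}(Z)$ is the set of $z$ with $z*w=w$ for all $w$. $Z$ is Laver-like if $\mathrm{Li}(Z)$ is a left-ideal ($w\in\mathrm{Li}(Z)\Rightarrow z*w\in\mathrm{Li}(Z)$) and for every sequence $(z_n)_{n\in\omega}$ in $Z$ there is $n$ with $(\cdots(z_0*z_1)*\cdots)*z_n\in\mathrm{Li}(Z)$. A partially endomorphic algebra is Laver-like if its hull $\Gamma(V,(f^\sharp)_{f\in E})$ is Laver-like; it is locally Laver-like if for all finite $U\subseteq E$, $W\subseteq F$,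 every finitely generated subalgebra of the reduct $(V,(f^\sharp)_{f\in U},(\mathfrak{g}^{\mathcal{V}})_{\mathfrak{g}\in W})$ is Laver-like. $\mathbf{T}_{\mathcal{G}}(X)$ is the set of terms over $\mathcal{G}$ with variables in $X$. Operability of a set $L\subseteq\mathbf{T}_{\mathcal{G}}(X)$ that is closed under subterms, contains $X$, is closed under the symbols of $F$, and satisfies $f_x(\ell_1,\dots,\ell_n)\in L$ iff $f_y(\ell_1,\dots,\ell_n)\in L$: let $\Omega=\{(f,\ell_1,\dots,\ell_{n_f})\mid f\in E,\ \ell_i\in L\}$. By transfinite recursion some elements of $\Omega$ get an ordinal rank, and $f^\sharp(\ell_1,\dots,\ell_{n_f},\ell)\in L$ is defined for all $\ell\in L$ once $(f,\ell_1,\dots,\ell_{n_f})$ has a rank. If $f_x(\ell_1,\dots,\ell_{n_f})\notin L$, then the rank is $0$ and $f^\sharp(\ell_1,\dots,\ell_{n_f},\ell)=\ell$. For $\alpha>0$ and $w=(g,\ell_1,\dots,\ell_n)\in\Omega$ with no rank $<\alpha$, define a partial function $Q:L\to L$ by recursion: $Q(x)=g_x(\ell_1,\dots,\ell_n)$ for $x\in X$; $Q(\mathfrak{f}(u_1,\dots,u_m))=\mathfrak{f}(Q(u_1),\dots,Q(u_m))$ for $\mathfrak{f}\in F$ if all $Q(u_i)$ are defined; $Q(f_x(u_1,\dots,u_m))=f^\sharp(Q(u_1),\dots,Q(u_m),g_x(\ell_1,\dots,\ell_n))$ for $f\in E$ if all $Q(u_i)$ are defined and $(f,Q(u_1),\dots,Q(u_m))$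 has rank $<\alpha$; otherwise undefined. If $Q$ is total, $w$ has rank $\alpha$ and $g^\sharp(\ell_1,\dots,\ell_n,\ell)=Q(\ell)$. $L$ is operable if every element of $\Omega$ has a rank. For finite $Y\subseteq X$, $U\subseteq E$, $W\subseteq F$ let $L_{Y,U,W}$ be the set of terms in $L$ using only variables from $Y$ and symbols $f_y$ ($f\in U,y\in Y$) and $\mathfrak{g}\in W$. $L$ is locally operable if all $L_{Y,U,W}$ are operable (with $Y,U,W$ in place of $X,E,F$); then the operations $g^\sharp$ on these sets fit together to operations $g^\sharp:L^{n_g+1}\to L$ ($g\in E$). The algebra $(L,(g^\sharp)_{g\in E},(\mathfrak{g})_{\mathfrak{g}\in F})$, with $\mathfrak{g}\in F$ acting as term formation, is then called a partially pre-endomorphic Laver table, and a partially endomorphic Laver table if in addition it is a partially endomorphic algebra.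
   Formalization: Part (2) is proved only when E is empty or some f in E has n_f > 0; if E is nonempty and all n_f = 0, then (2) can fail (V = {0,1}, f^♯ = negation, F empty, X = {x}), since Li is the whole hull and f^♯ is the identity on L. *)

(* Defs.v *)
From mathcomp Require Import all_boot.
From mathcomp Require Import boolp classical_sets functions cardinality.

Set Implicit Arguments.
Unset Strict Implicit.
Unset Printing Implicit Defensive.

Local Open Scope classical_set_scope.

(* The type (E, F) of an algebra.  An n-tuple of elements of T is represented *)
(* by a function 'I_n -> T.                                                   *)
Record signature := Signature {
  Esym : Type;
  Fsym : Type;
  Ear : Esym -> nat;
  Far : Fsym -> nat }.

Record algebra (S : signature) (V : Type) := Algebra {
  sharp : forall f : Esym S, ('I_(Ear f) -> V) -> V -> V;
  fop : forall g : Fsym S, ('I_(Far g) -> V) -> V }.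

Definition homomorphism (S : signature) (V V' : Type)
    (A : algebra S V) (B : algebra S V') (h : V -> V') : Prop :=
  (forall (f : Esym S) a y, h (sharp A (f:=f) a y) = sharp B (h \o a) (h y)) /\
  (forall (g : Fsym S) a, h (fop A (g:=g) a) = fop B (h \o a)).

Definition partially_endomorphic (S : signature) (V : Type)
    (A : algebra S V) : Prop :=
  forall (f : Esym S) a, homomorphism A A (sharp A (f:=f) a).

Definition Li (Z : Type) (mul : Z -> Z -> Z) : set Z :=
  [set z | forall w, mul z w = w].

Fixpoint left_product (Z : Type) (mul : Z -> Z -> Z) (z : nat -> Z) (n : nat) :=
  if n is m.+1 then mul (left_product mul z m) (z n) else z 0.

(* [right_distributive mul mul] is x * (y * z) = (x * y) * (x * z). *)
Definition Laver_like (Z : Type) (mul : Z -> Z -> Z) : Prop :=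
  [/\ right_distributive mul mul,
      (forall z w, Li mul w -> Li mul (mul z w)) &
      (forall z : nat -> Z, exists n, Li mul (left_product mul z n))].

Definition hull (S : signature) (V : Type) := {f : Esym S & 'I_(Ear f) -> V}.

Definition hull_elt (S : signature) (V : Type) (f : Esym S)
    (a : 'I_(Ear f) -> V) : hull S V :=
  existT (fun f : Esym S => 'I_(Ear f) -> V) f a.

Definition hargs (S : signature) (V : Type) (w : hull S V) :
    'I_(Ear (tag w)) -> V := projT2 w.

Arguments hargs {S V} w.

Definition hull_mul (S : signature) (V : Type) (A : algebra S V)
    (s t : hull S V) : hull S V :=
  hull_elt (fun i => sharp A (hargs s) (hargs t i)).

Definition Laver_like_algebra (S : signature) (V : Type)
    (A : algebra S V) : Prop :=
  Laver_like (hull_mul A).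

(* If E is nonempty and all the n_f (f in E) are 0, then every element of the *)
(* hull is in Li, whether or not the unary operations f^# are identity maps.  *)
Definition degenerate (S : signature) : Prop :=
  (exists f : Esym S, True) /\ (forall f : Esym S, Ear f = 0).

Definition restrict (S : signature) (U : set (Esym S)) (W : set (Fsym S)) :
    signature :=
  @Signature U W (fun f => Ear (val f)) (fun g => Far (val g)).

Definition reduct (S : signature) (V : Type) (A : algebra S V)
    (U : set (Esym S)) (W : set (Fsym S)) : algebra (restrict U W) V :=
  @Algebra (restrict U W) V (fun f => sharp A (f:=val f))
    (fun g => fop A (g:=val g)).

Definition subuniverse (S : signature) (V : Type) (A : algebra S V)
    (B : set V) : Prop :=
  (forall (f : Esym S) a y, (forall i, B (a i)) -> B y ->
     B (sharp A (f:=f) a y)) /\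
  (forall (g : Fsym S) a, (forall i, B (a i)) -> B (fop A (g:=g) a)).

Definition subalgebra (S : signature) (V : Type) (A : algebra S V)
    (B : set V) (clB : subuniverse A B) : algebra S B :=
  @Algebra S B
    (fun f (a : 'I_(Ear f) -> B) (y : B) =>
       exist _ (sharp A (fun i => val (a i)) (val y))
         (mem_set (clB.1 f _ _ (fun i => set_valP (a i)) (set_valP y))))
    (fun g (a : 'I_(Far g) -> B) =>
       exist _ (fop A (fun i => val (a i)))
         (mem_set (clB.2 g _ (fun i => set_valP (a i))))).

Definition locally_Laver_like (S : signature) (V : Type)
    (A : algebra S V) : Prop :=
  forall (U : set (Esym S)) (W : set (Fsym S)), finite_set U -> finite_set W ->
  forall (B : set V) (clB : subuniverse (reduct A U W) B),
    (exists2 G, finite_set G & B = smallest (subuniverse (reduct A U W)) G) ->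
    Laver_like_algebra (subalgebra clB).

(* [Eterm f x u] is f_x(u_1, ..., u_n). *)
Inductive term (S : signature) (X : Type) : Type :=
| Var of X
| Fterm (g : Fsym S) of ('I_(Far g) -> term S X)
| Eterm (f : Esym S) of X & ('I_(Ear f) -> term S X).

Arguments Var {S X}.
Arguments Fterm {S X}.
Arguments Eterm {S X}.

(* The terms over the variables in Y and the symbols f_y (f in U, y in Y) and *)
(* g in W form the type [term (restrict U W) Y], which [incl] embeds in       *)
(* [term S X].                                                                *)
Fixpoint incl (S : signature) (X : Type) (Y : set X)
    (U : set (Esym S)) (W : set (Fsym S)) (t : term (restrict U W) Y) :
    term S X :=
  match t with
  | Var y => Var (val y)
  | Fterm g u => Fterm (val g) (fun i => incl (u i))
  | Eterm f y u => Eterm (val f) (val y) (fun i => incl (u i))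
  end.

(* Ordinals: [osup a] is the least ordinal greater than all the [a j], so the *)
(* ordinals below it are those that are at most some [a j].  Distinct terms   *)
(* may denote the same ordinal.                                               *)
Inductive ordinal_number : Type :=
| osup (J : Type) of (J -> ordinal_number).

Definition ozero (al : ordinal_number) : Prop :=
  let: osup J _ := al in J -> False.

Section Operability.
Variables (S : signature) (X : Type) (L : set (term S X)).

Definition admissible : Prop :=
  [/\ (forall x, L (Var x)),
      (forall g u, L (Fterm g u) <-> forall i, L (u i)),
      (forall f x u, L (Eterm f x u) -> forall i, L (u i)) &
      (forall f x y u, L (Eterm f x u) <-> L (Eterm f y u))].

Definition Omega : set (hull S (term S X)) :=
  [set w | forall i, L (hargs w i)].

(* In the next two definitions, [R w q] means that w has already been given   *)
(* a rank, with w = (f, l_1, ..., l_n), and that f^#(l_1, ..., l_n, l) = q l  *)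
(* for all l in L; the values of q outside L are irrelevant.                  *)

(* The graph of the partial function Q attached to w. *)
Inductive Qgraph (R : hull S (term S X) -> (term S X -> term S X) -> Prop)
    (w : hull S (term S X)) : term S X -> term S X -> Prop :=
| Qvar x : Qgraph R w (Var x) (Eterm (tag w) x (hargs w))
| QF g u v : (forall i, Qgraph R w (u i) (v i)) ->
    Qgraph R w (Fterm g u) (Fterm g v)
| QE f x u v q : (forall i, Qgraph R w (u i) (v i)) ->
    R (hull_elt v) q ->
    Qgraph R w (Eterm f x u) (q (Eterm (tag w) x (hargs w))).

(* w gets the rank al and the operation q, where R collects the assignments   *)
(* of rank < al.  When L is admissible, whether f_x(l_1, ..., l_n) is in L    *)
(* does not depend on x.                                                      *)
Definition gets_rank (al : ordinal_number)
    (R : hull S (term S X) -> (term S X -> term S X) -> Prop)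
    (w : hull S (term S X)) (q : term S X -> term S X) : Prop :=
  Omega w /\
  ((ozero al /\ (forall x, ~ L (Eterm (tag w) x (hargs w))) /\
      (forall l, L l -> q l = l)) \/
   (~ ozero al /\ ~ (exists q', R w q') /\
      (forall l, L l -> Qgraph R w l (q l)))).

Fixpoint rank_below (al : ordinal_number) (w : hull S (term S X))
    (q : term S X -> term S X) : Prop :=
  let: osup J a := al in
  exists j : J, rank_below (a j) w q \/ gets_rank (a j) (rank_below (a j)) w q.

Definition has_rank (al : ordinal_number) (w : hull S (term S X))
    (q : term S X -> term S X) : Prop :=
  gets_rank al (rank_below al) w q.

(* w has a rank, and the operation attached to it is q. *)
Definition ranked (w : hull S (term S X)) (q : term S X -> term S X) : Prop :=
  exists al, has_rank al w q.

Definition operable : Prop :=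
  admissible /\ forall w, Omega w -> exists q, ranked w q.

(* L_{Y,U,W} *)
Definition local_part (Y : set X) (U : set (Esym S)) (W : set (Fsym S)) :
    set (term (restrict U W) Y) :=
  [set t | L (incl t)].

End Operability.

Definition locally_operable (S : signature) (X : Type)
    (L : set (term S X)) : Prop :=
  forall (Y : set X) (U : set (Esym S)) (W : set (Fsym S)),
    finite_set Y -> finite_set U -> finite_set W ->
    operable (local_part L (Y:=Y) (U:=U) (W:=W)).

(* A is the algebra (L, (f^#), (g)): its operations f^# extend those of all   *)
(* the L_{Y,U,W}, and its operations g are term formation.                    *)
Definition pre_endomorphic_Laver_table (S : signature) (X : Type)
    (L : set (term S X)) (A : algebra S L) : Prop :=
  [/\ locally_operable L,
      (forall (Y : set X) (U : set (Esym S)) (W : set (Fsym S)),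
         finite_set Y -> finite_set U -> finite_set W ->
         forall (w : hull (restrict U W) (term (restrict U W) Y)) q,
           ranked (local_part L (Y:=Y) (U:=U) (W:=W)) w q ->
         forall (a : 'I_(Ear (val (tag w))) -> L) (l : L)
                (t : term (restrict U W) Y),
           (forall i, val (a i) = incl (hargs w i)) -> val l = incl t ->
           val (sharp A (f:=val (tag w)) a l) = incl (q t)) &
      (forall (g : Fsym S) (a : 'I_(Far g) -> L),
         val (fop A a) = Fterm g (fun i => val (a i)))].

Definition partially_endomorphic_Laver_table (S : signature) (X : Type)
    (L : set (term S X)) (A : algebra S L) : Prop :=
  pre_endomorphic_Laver_table A /\ partially_endomorphic A.

Section Domain.
Variables (S : signature) (V : Type) (A : algebra S V).
Variables (X : Type) (v : X -> V).

(* The equations for phi make sense on all terms; phi is the restriction of   *)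
(* [eval] to L.                                                               *)
Fixpoint eval (t : term S X) : V :=
  match t with
  | Var x => v x
  | Fterm g u => fop A (fun i => eval (u i))
  | Eterm f x u => sharp A (fun i => eval (u i)) (v x)
  end.

Fixpoint in_domain (t : term S X) : Prop :=
  match t with
  | Var x => True
  | Fterm g u => forall i, in_domain (u i)
  | Eterm f x u =>
      (forall i, in_domain (u i)) /\
      ~ Li (hull_mul A) (@hull_elt S V f (fun i => eval (u i)))
  end.

Definition domain : set (term S X) := [set t | in_domain t].

Definition phi (l : domain) : V := eval (val l).

End Domain.

(* Main.v *)
Require Import Defs.
From mathcomp Require Import all_boot.
From mathcomp Require Import boolp classical_sets functions cardinality.
(* [restrict] and [incl] also name notions on sets and functions. *)
Import Defs.

(** Write w * z for the product of the hull of L.  Evaluation maps it to the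
product of the hull of V, and the recursion defining w on terms only calls
products w * z, where w and z are nontrivial (they are heads of terms in L).  An
infinite chain w, w * z_1, (w * z_1) * z_2, ... of such calls would evaluate to
left products in a Laver-like hull, hence reach Li, where w is trivial.  So the
recursion is well-founded on each finitely generated part of L.  Since an
idempotent of a Laver-like hull lies in Li, the set Li of a finitely generated
subalgebra is contained in that of V, and Li is a left ideal of the whole hull.
The identity w(z(t)) = (w * z)(w(t)) follows by induction on (w, z, t).  For
degenerate S there are no nontrivial w, and V can be replaced by a point. *)

Set Implicit Arguments.
Unset Strict Implicit.
Unset Printing Implicit Defensive.

Local Open Scope classical_set_scope.

(** * Action of hull elements on terms, and its relation to ranks *)

Section Action.
Variables (S : signature) (X : Type) (L : set (term S X)).
Implicit Types (w z : hull S (term S X)) (t : term S X).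

Definition nontrivial w : Prop := exists x, L (Eterm (tag w) x (hargs w)).

(** Big-step form of the recursion for the operations f^#: a derivation takes over the role of the
    ordinal rank. In [act_E] the remaining call acts on the head of w. *)
Inductive act : hull S (term S X) -> term S X -> term S X -> Prop :=
| act_id w t : ~ nontrivial w -> act w t t
| act_Var w x : nontrivial w -> act w (Var x) (Eterm (tag w) x (hargs w))
| act_F w g u u' : nontrivial w -> (forall i, act w (u i) (u' i)) ->
    act w (Fterm g u) (Fterm g u')
| act_E w f x u u' t : nontrivial w -> (forall i, act w (u i) (u' i)) ->
    act (hull_elt u') (Eterm (tag w) x (hargs w)) t ->
    act w (Eterm f x u) t.

Lemma act_inv w t t' : act w t t' ->
  (~ nontrivial w /\ t' = t) \/
  (nontrivial w /\
   match t with
   | Var x => t' = Eterm (tag w) x (hargs w)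
   | Fterm g u => exists2 u', (forall i, act w (u i) (u' i)) & t' = Fterm g u'
   | Eterm f x u => exists2 u' : 'I_(Ear f) -> term S X,
       (forall i, act w (u i) (u' i)) &
       act (hull_elt u') (Eterm (tag w) x (hargs w)) t'
   end).
Proof. by case=> *; [left|right|right|right]; split=> //; eexists; eauto. Qed.

Lemma act_functional w t t1 t2 : act w t t1 -> act w t t2 -> t1 = t2.
Proof.
move=> h; elim: h t2 => {w t t1}.
- by move=> w t nw t2 /act_inv [[]|[]].
- by move=> w x nw t2 /act_inv [[]|[]].
- move=> w g u u' nw _ IH t2 /act_inv [[]//|[_ [u2 h ->]]].
  by congr Fterm; apply: funext => i; exact: IH.
- move=> w f x u u' t nw _ IH _ IH' t2 /act_inv [[]//|[_ [u2 h]]].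
  suff -> : u2 = u' by exact: IH'.
  by apply: funext => i; exact/esym/IH.
Qed.

Definition act_total : Prop :=
  forall w t, Omega L w -> L t -> exists t', act w t t'.

Definition apply w t : term S X :=
  if pselect (exists t', act w t t') is left e then sval (cid e) else t.

Lemma applyE w t t' : act w t t' -> apply w t = t'.
Proof.
move=> h; rewrite /apply; case: pselect => [e|[]]; last by exists t'.
by apply: act_functional h; case: (cid e).
Qed.

Lemma actP w t : act_total -> Omega L w -> L t -> act w t (apply w t).
Proof. by move=> tot ow lt; have [t' h] := tot w t ow lt; rewrite (applyE h). Qed.

Lemma apply_id w t : ~ nontrivial w -> apply w t = t.
Proof. by move=> nw; apply/applyE/act_id. Qed.

Definition mul_hull w z : hull S (term S X) :=
  hull_elt (fun i => apply w (hargs z i)).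

Hypothesis admL : admissible L.

Lemma nontrivialP w x : nontrivial w -> L (Eterm (tag w) x (hargs w)).
Proof. by case: admL => _ _ _ h [y hy]; exact: (h _ x y _).2 hy. Qed.

Lemma nontrivial_Omega w : nontrivial w -> Omega L w.
Proof. by case: admL => _ _ h _ [y hy] i; exact: h hy i. Qed.

(** Descending through the indices of a nonzero ordinal reaches a zero one, where w gets its rank.
    Hence an element still without rank at a nonzero stage is nontrivial, as the rules of [act] for
    such stages require. *)
Lemma rank_below_id al w q : ~ ozero al -> Omega L w -> ~ nontrivial w ->
  (forall l, L l -> q l = l) -> rank_below L al w q.
Proof.
move=> + ow nw qid; elim: al => J a IH nz.
have [j _] : exists j : J, True by apply: contrapT => h; apply: nz => j; case: h; exists j.
exists j; case: (pselect (ozero (a j))) => [z|/IH]; last by left.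
by right; split=> //; left; split=> //; split=> // x h; apply: nw; exists x.
Qed.

Lemma Qgraph_act (R : hull S (term S X) -> (term S X -> term S X) -> Prop) w :
  (forall z q, R z q -> forall t, L t -> act z t (q t)) ->
  nontrivial w -> forall t t', L t -> Qgraph R w t t' -> act w t t'.
Proof.
case: (admL) => _ lF lE _ sR nw t t' + h; elim: h => {t t'}.
- by move=> x _; exact: act_Var.
- by move=> g u u' _ IH /lF lu; apply: act_F => // i; exact: IH.
- move=> f x u u' q _ IH r /lE lu; apply: act_E => //.
    by move=> i; apply: IH.
  by apply: sR => //; exact: nontrivialP.
Qed.

Lemma gets_rank_act al R w q :
  (forall z q', R z q' -> forall t, L t -> act z t (q' t)) ->
  (~ ozero al -> Omega L w -> ~ nontrivial w -> exists q', R w q') ->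
  gets_rank L al R w q -> forall t, L t -> act w t (q t).
Proof.
move=> sR zR [ow [[z [nw qid]]|[nz [nR qQ]]]] t lt.
  by rewrite qid //; apply: act_id => -[x]; exact: nw.
apply: (Qgraph_act sR) => //; last exact: qQ.
by apply: contrapT => nw; exact/nR/zR.
Qed.

Lemma has_rank_act al w q : has_rank L al w q -> forall t, L t -> act w t (q t).
Proof.
have zR be z : ~ ozero be -> Omega L z -> ~ nontrivial z -> exists q', rank_below L be z q'.
  by move=> *; exists id; exact: rank_below_id.
apply: gets_rank_act; last exact: zR.
elim: al => J a IH z q' [j [/IH//|]]; apply: gets_rank_act; last exact: zR.
exact: IH.
Qed.

Lemma ranked_act w q : ranked L w q -> forall t, L t -> act w t (q t).
Proof. by case=> al /has_rank_act. Qed.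

Lemma rank_below_ranked al w q : rank_below L al w q -> ranked L w q.
Proof. by elim: al => J a IH [j [/IH//|h]]; exists (a j). Qed.

Lemma Qgraph_mono (R R' : hull S (term S X) -> (term S X -> term S X) -> Prop) w :
  (forall z q, R z q -> R' z q) -> forall t t', Qgraph R w t t' -> Qgraph R' w t t'.
Proof.
move=> RR' t t'; elim=> {t t'} *; first exact: Qvar.
- exact: QF.
- by apply: QE; auto.
Qed.

(** Replaces the bookkeeping of ordinals by a closure property, so that operability can be proved by
    well-founded induction on hull elements. *)
Lemma rankedI w : Omega L w ->
  (forall t, L t -> exists t', Qgraph (ranked L) w t t') -> exists q, ranked L w q.
Proof.
move=> ow totQ; apply: contrapT => nr.
(* [osup a] is an ordinal above all the ranks. *)
pose J := {p : hull S (term S X) * (term S X -> term S X) | ranked L p.1 p.2}.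
pose a (j : option J) : ordinal_number :=
  if j is Some p then sval (cid (svalP p)) else osup (fun e : False => match e with end).
have ranked_below z q : ranked L z q -> rank_below L (osup a) z q.
  move=> r; pose p : J := exist _ (z, q) r.
  by exists (Some p); right; rewrite /a; case: (cid _) => al h; exact: h.
have [q hq] : exists q, forall t, L t -> Qgraph (rank_below L (osup a)) w t (q t).
  have /choice [q hq] : forall t, exists t', L t -> Qgraph (rank_below L (osup a)) w t t'.
    move=> t; have [/totQ [t' h]|] := pselect (L t); last by exists t.
    by exists t' => _; exact: Qgraph_mono h.
  by exists q.
(* The extra index [None] keeps [osup a] nonzero even if nothing is ranked yet. *)
apply: (nr); exists q, (osup a); split=> //; right; split; first by move=> /(_ None).
by split=> // -[q' /rank_below_ranked r]; apply: nr; exists q'.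
Qed.

End Action.

(** * Evaluation, termination and self-distributivity over an abstract Li *)

Definition hull_map (S : signature) (V V' : Type) (h : V -> V') (w : hull S V) :
  hull S V' := hull_elt (fun i => h (hargs w i)).

(** The set [I] stands for Li. It is kept abstract because on the parts L_{Y,U,W} membership of
    terms is governed by Li of the whole hull, which can differ from Li of the hull of the reduct,
    and because the degenerate case uses another algebra. *)
Record model (S : signature) (V : Type) (A : algebra S V) (X : Type)
    (v : X -> V) (I : set (hull S V)) (L : set (term S X)) : Prop := Model {
  model_endo : partially_endomorphic A;
  model_id : forall (f : Esym S) a y,
    I (@hull_elt S V f a) -> sharp A (f:=f) a y = y;
  model_ideal : forall w z, I z -> I (hull_mul A w z);
  model_Var : forall x, L (Var x);
  model_F : forall g u, L (Fterm g u) <-> forall i, L (u i);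
  model_E : forall f x u, L (Eterm f x u) <->
    (forall i, L (u i)) /\ ~ I (@hull_elt S V f (fun i => eval A v (u i))) }.

(** Only values of terms are multiplied, so this concerns just the subalgebra generated by the
    v_x. *)
Definition terminating (S : signature) (V : Type) (A : algebra S V) (X : Type)
    (v : X -> V) (I : set (hull S V)) : Prop :=
  forall z : nat -> hull S (term S X), exists n,
    I (left_product (hull_mul A) (fun n => hull_map (eval A v) (z n)) n).

Section Model.
Variables (S : signature) (V : Type) (A : algebra S V) (X : Type) (v : X -> V).
Variables (I : set (hull S V)) (L : set (term S X)).
Hypothesis mL : model A v I L.
Implicit Types (w z : hull S (term S X)) (t : term S X).
Let ev := eval A v.

Lemma model_admissible : admissible L.
Proof.
split; [exact: model_Var mL|exact: model_F mL| |].
- by move=> f x u /(model_E mL) [].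
- by move=> f x y u; split=> /(model_E mL)/(model_E mL).
Qed.
Let admL := model_admissible.

(** If X is empty nothing is nontrivial, whatever the value of w; hence the argument [x]. *)
Lemma nontrivialE w (x : X) : Omega L w ->
  nontrivial L w <-> ~ I (hull_map ev w).
Proof.
move=> ow; split=> [[y /(model_E mL)[]]//|nI].
by exists x; apply/(model_E mL).
Qed.

(** A variable in t turns triviality of w into membership of its value in [I], whose elements act as
    the identity. Symbols of F are passed by the endomorphism property, which also settles the case
    of an empty X. *)
Lemma trivial_sharp w t : Omega L w -> ~ nontrivial L w ->
  sharp A (hargs (hull_map ev w)) (ev t) = ev t.
Proof.
move=> ow nw.
have Iw (x : X) : I (hull_map ev w).
  by apply: contrapT => nI; apply/nw/(nontrivialE x).
elim: t => [x|g u IH|f x u _] /=.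
- exact/(model_id mL)/Iw.
- rewrite (model_endo mL (hargs (hull_map ev w))).2.
  by congr fop; apply: funext.
- exact/(model_id mL)/Iw.
Qed.

(** For t = f_x(u) this is the endomorphism property in V: w^# maps f^#(u, v_x) to f^#(w^# u, w^#
    v_x), and w^# v_x is the value of the head of w. *)
Lemma act_eval w t t' : act L w t t' -> Omega L w -> L t ->
  L t' /\ ev t' = sharp A (hargs (hull_map ev w)) (ev t).
Proof.
have E := model_endo mL.
move=> h; elim: h => {w t t'}.
- by move=> w t nw ow lt; rewrite trivial_sharp.
- by move=> w x nw _ _; split=> //; exact: nontrivialP.
- move=> w g u u' nw _ IH ow /(model_F mL) lu; split.
    by apply/(model_F mL) => i; case: (IH i).
  rewrite /= (E _ _).2; congr fop; apply: funext => i.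
  by case: (IH i ow (lu i)).
- move=> w f x u u' t nw _ IH _ IH' ow /(model_E mL) [lu _].
  have ou' : Omega L (hull_elt u') by move=> i; case: (IH i ow (lu i)).
  have [lt ->] := IH' ou' (nontrivialP admL x nw); split=> //.
  rewrite /= (E _ (hargs (hull_map ev w))).1 /=; congr sharp.
  by apply: funext => i /=; case: (IH i ow (lu i)).
Qed.

Section Total.
Hypothesis tot : act_total L.

Lemma apply_in w t : Omega L w -> L t -> L (apply L w t).
Proof. by move=> ow lt; case: (act_eval (actP tot ow lt) ow lt). Qed.

Lemma eval_apply w t : Omega L w -> L t ->
  ev (apply L w t) = sharp A (hargs (hull_map ev w)) (ev t).
Proof. by move=> ow lt; case: (act_eval (actP tot ow lt) ow lt). Qed.

Lemma Omega_mul_hull w z : Omega L w -> Omega L z -> Omega L (mul_hull L w z).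
Proof. by move=> ow oz i; apply: apply_in. Qed.

Lemma hull_map_mul_hull w z : Omega L w -> Omega L z ->
  hull_map ev (mul_hull L w z) = hull_mul A (hull_map ev w) (hull_map ev z).
Proof.
move=> ow oz; congr hull_elt; apply: funext => i.
exact: eval_apply.
Qed.

Lemma apply_Var w x : nontrivial L w ->
  apply L w (Var x) = Eterm (tag w) x (hargs w).
Proof. by move=> nw; apply/applyE/act_Var. Qed.

Lemma apply_F w g u : Omega L w -> (forall i, L (u i)) ->
  apply L w (Fterm g u) = Fterm g (fun i => apply L w (u i)).
Proof.
move=> ow lu; have [nw|nw] := pselect (nontrivial L w).
  by apply/applyE/act_F => // i; exact: actP.
by rewrite apply_id //; congr Fterm; apply: funext => i; rewrite apply_id.
Qed.

Lemma apply_E w f x u : nontrivial L w -> (forall i, L (u i)) ->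
  apply L w (Eterm f x u) =
  apply L (mul_hull L w (hull_elt u)) (Eterm (tag w) x (hargs w)).
Proof.
move=> nw lu; have ow := nontrivial_Omega admL nw.
apply/applyE/act_E => //; first by move=> i; exact: actP.
apply: actP => //; last exact: nontrivialP.
exact: (@Omega_mul_hull w (hull_elt u)).
Qed.

End Total.

Hypothesis term_v : terminating A v I.

(** This is z = w * s, stated by [act] because totality, which gives [apply] its meaning, is itself
    proved by induction along this relation. *)
Definition below z w : Prop := exists s, [/\ nontrivial L w, nontrivial L s &
  exists2 u : 'I_(Ear (tag s)) -> term S X,
    z = hull_elt u & forall i, act L w (hargs s i) (u i)].

Lemma below_hull_mul z w : below z w -> [/\ Omega L z, ~ I (hull_map ev w) &
  exists s, hull_map ev z = hull_mul A (hull_map ev w) (hull_map ev s)].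
Proof.
move=> [s [nw ns [u -> h]]].
have ow := nontrivial_Omega admL nw; have os := nontrivial_Omega admL ns.
split.
- by move=> i; case: (act_eval (h i) ow (os i)).
- by case: (nw) => x _; apply/(nontrivialE x).
- exists s; congr hull_elt; apply: funext => i.
  by case: (act_eval (h i) ow (os i)).
Qed.

(* Along an infinite descending chain the values of the hull elements would   *)
(* be left products, so one of them would lie in I; nothing is below that.    *)
Lemma below_wf w : Acc below w.
Proof.
pose bad z := ~ Acc below z.
have /choice [F hF] : forall z, exists p : hull S (term S X) * hull S (term S X),
    bad z -> [/\ bad p.1, ~ I (hull_map ev z) &
      hull_map ev p.1 = hull_mul A (hull_map ev z) (hull_map ev p.2)].
  move=> z; have [bz|] := pselect (bad z); last by exists (z, z).
  have [z1 [b1 n1]] : exists z1, below z1 z /\ bad z1.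
    apply: contrapT => h; apply: bz; constructor=> z1 b1.
    by apply: contrapT => n1; apply: h; exists z1.
  have [_ nI [s hs]] := below_hull_mul b1.
  by exists (z1, s).
apply: contrapT => bw.
(* The chain is [d], and [s] lists its factors after the start w, so that [d] evaluates to the left
   products of [s]. *)
pose d n := iter n (fun z => (F z).1) w.
have bd n : bad (d n) by elim: n => //= n /hF [].
pose s n := if n is m.+1 then (F (d m)).2 else w.
have [n] := term_v s.
suff -> : left_product (hull_mul A) (fun n => hull_map ev (s n)) n = hull_map ev (d n).
  by have [] := hF _ (bd n).
elim: n => //= n ->.
by have [_ _ ->] := hF _ (bd n).
Qed.

(** For t = f_x(u) the last call acts on the head of w, which is no subterm of t, but by an element
    below w. So the outer induction is on [below] and the inner one on t. *)
Lemma model_total : act_total L.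
Proof.
move=> w; elim: (below_wf w) => {}w _ IH t ow lt.
have [nw|nw] := pselect (nontrivial L w); last by exists t; exact: act_id.
elim: t lt => [x _|g u IHu /(model_F mL) lu|f x u IHu lfu].
- by exists (Eterm (tag w) x (hargs w)); exact: act_Var.
- have /choice [u' hu'] : forall i, exists t', act L w (u i) t' by auto.
  by exists (Fterm g u'); exact: act_F.
- have /(model_E mL) [lu _] := lfu.
  have /choice [u' hu'] : forall i, exists t', act L w (u i) t' by auto.
  have b : below (hull_elt u') w.
    by exists (hull_elt u); split=> //; [exists x|exists u'].
  have [oz _ _] := below_hull_mul b.
  have [t' ht'] := IH _ b _ oz (nontrivialP admL x nw).
  by exists t'; apply: act_E ht'.
Qed.

Lemma model_operable : operable L.
Proof.
split=> // w; elim: (below_wf w) => {}w _ IH ow.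
have [nw|nw] := pselect (nontrivial L w); last first.
  exists id, (osup (fun e : False => match e with end)).
  by split=> //; left; split=> //; split=> // x h; apply: nw; exists x.
apply: rankedI => // t lt.
(* The same value is tracked in [act], which is what shows that the calls are below w. *)
suff [t' []] : exists t', Qgraph (ranked L) w t t' /\ act L w t t' by exists t'.
elim: t lt => [x _|g u IHu /(model_F mL) lu|f x u IHu lfu].
- by exists (Eterm (tag w) x (hargs w)); split; [exact: Qvar|exact: act_Var].
- have /choice [u' hu'] i := IHu i (lu i).
  by exists (Fterm g u'); split; [apply: QF|apply: act_F] => // i; case: (hu' i).
- have /(model_E mL) [lu _] := lfu.
  have /choice [u' hu'] i := IHu i (lu i).
  have b : below (hull_elt u') w.
    exists (hull_elt u); split=> //; first by exists x.
    by exists u' => // i; case: (hu' i).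
  have [oz _ _] := below_hull_mul b.
  have [q hq] := IH _ b oz.
  exists (q (Eterm (tag w) x (hargs w))); split.
    by apply: QE hq => i; case: (hu' i).
  apply: (act_E (u' := u')) => //; first by move=> i; case: (hu' i).
  exact: (ranked_act admL hq (nontrivialP admL x nw)).
Qed.

Let tot := model_total.

Lemma below_mul_hull w z : nontrivial L w -> nontrivial L z ->
  below (mul_hull L w z) w.
Proof.
move=> nw nz; have ow := nontrivial_Omega admL nw.
have oz := nontrivial_Omega admL nz.
exists z; split=> //; eexists=> // i; exact: actP.
Qed.

(* Lexicographic induction on (w, z, t): for t = f_x(u) in L, the hull element *)
(* w * z is below w, and z * (f, u) is below z.                               *)
Lemma apply_apply w z t : Omega L w -> Omega L z -> L t ->
  apply L w (apply L z t) = apply L (mul_hull L w z) (apply L w t).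
Proof.
move=> ow oz.
elim: (below_wf w) ow z oz t => {}w _ IHw ow z oz.
elim: (below_wf z) oz => {}z _ IHz oz t.
have [nw|nw] := pselect (nontrivial L w); last first.
  have -> : mul_hull L w z = z.
    case: z {IHz oz} => f a; congr existT; apply: funext => i.
    exact: apply_id.
  by rewrite !(apply_id _ nw).
have owz := Omega_mul_hull tot ow oz.
have [nz|nz] := pselect (nontrivial L z); last first.
  (* As [I] is a left ideal, w * z is trivial together with z. *)
  rewrite !(apply_id _ nz) (@apply_id _ _ _ (mul_hull L w z)) // => -[x nwz].
  apply: nz; apply/(nontrivialE x) => // Iz.
  have /(nontrivialE x) : nontrivial L (mul_hull L w z) by exists x.
  by apply=> //; rewrite hull_map_mul_hull //; exact: (model_ideal mL).
elim: t => [x _|g u IHu /(model_F mL) lu|f x u IHu lfu].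
- by rewrite !apply_Var // apply_E.
- rewrite !apply_F //; last 2 first.
  + by move=> i; exact: apply_in.
  + by move=> i; exact: apply_in.
  by congr Fterm; apply: funext => i; exact: IHu.
- have /(model_E mL) [lu _] := lfu.
  pose s : hull S (term S X) := hull_elt u.
  have ns : nontrivial L s by exists x.
  have os : Omega L s by [].
  have lwx := nontrivialP admL x nw; have lzx := nontrivialP admL x nz.
  rewrite [apply L z _]apply_E // [apply L w (Eterm f _ _)]apply_E // -/s.
  (* Both sides become actions on the same term: by w * (z * s) on the left and by (w * z) * (w * s)
     on the right. These agree in each coordinate by induction on the arguments u. *)
  rewrite IHz //; [|exact: below_mul_hull|exact: Omega_mul_hull].
  rewrite [apply L w (Eterm _ _ _)]apply_E //.
  have -> : hull_elt (hargs z) = z by case: (z).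
  rewrite (IHw (mul_hull L w z)) //; [|exact: below_mul_hull|exact: Omega_mul_hull].
  congr apply; congr hull_elt; apply: funext => i /=.
  exact: IHu.
Qed.

End Model.

(** * Exhausting terms by finitely many variables and symbols *)

Definition hull_incl (S : signature) (V : Type) (U : set (Esym S))
    (W : set (Fsym S)) (w : hull (restrict U W) V) : hull S V :=
  @hull_elt S V (val (tag w)) (hargs w).

Section LocalParts.
Variables (S : signature) (X : Type).

(* P holds for all large enough Y, U, W, among which there are finite ones.   *)
Definition eventually
    (P : set X -> set (Esym S) -> set (Fsym S) -> Prop) : Prop :=
  exists Y U W, [/\ finite_set Y, finite_set U, finite_set W &
    forall Y' U' W', Y `<=` Y' -> U `<=` U' -> W `<=` W' -> P Y' U' W'].

Lemma eventually_ex P : eventually P ->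
  exists Y U W, [/\ finite_set Y, finite_set U, finite_set W & P Y U W].
Proof. by case=> Y [U [W [fY fU fW h]]]; exists Y, U, W; split=> //; exact: h. Qed.

Lemma eventually_and P Q : eventually P -> eventually Q ->
  eventually (fun Y U W => P Y U W /\ Q Y U W).
Proof.
move=> [Y [U [W [fY fU fW h]]]] [Y' [U' [W' [fY' fU' fW' h']]]].
exists (Y `|` Y'), (U `|` U'), (W `|` W'); split; rewrite ?finite_setU //.
move=> Y2 U2 W2; rewrite !subUset => -[? ?] [? ?] [? ?].
by split; [exact: h|exact: h'].
Qed.

Lemma eventually_all (n : nat)
    (P : 'I_n -> set X -> set (Esym S) -> set (Fsym S) -> Prop) :
  (forall i, eventually (P i)) ->
  eventually (fun Y U W => forall i, P i Y U W).
Proof.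
move=> /choice [Y /choice [U /choice [W h]]].
exists (\bigcup_i Y i), (\bigcup_i U i), (\bigcup_i W i); split.
- by apply: bigcup_finite => // i _; case: (h i).
- by apply: bigcup_finite => // i _; case: (h i).
- by apply: bigcup_finite => // i _; case: (h i).
move=> Y' U' W' sY sU sW i; case: (h i) => _ _ _; apply.
- exact: subset_trans (bigcup_sup _) sY.
- exact: subset_trans (bigcup_sup _) sU.
- exact: subset_trans (bigcup_sup _) sW.
Qed.

Lemma eventually_var x : eventually (fun Y U W => Y x).
Proof.
exists [set x], set0, set0; split=> // Y U W sY _ _.
exact: sY.
Qed.

Lemma eventually_Esym f : eventually (fun Y U W => U f).
Proof.
exists set0, [set f], set0; split=> // Y U W _ sU _.
exact: sU.
Qed.

Lemma eventually_Fsym g : eventually (fun Y U W => W g).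
Proof.
exists set0, set0, [set g]; split=> // Y U W _ _ sW.
exact: sW.
Qed.

Lemma eventually_mono (P Q : set X -> set (Esym S) -> set (Fsym S) -> Prop) :
  (forall Y U W, P Y U W -> Q Y U W) -> eventually P -> eventually Q.
Proof.
move=> PQ [Y [U [W [fY fU fW h]]]]; exists Y, U, W; split=> // *.
by apply: PQ; exact: h.
Qed.

(** A term contains finitely many symbols; upward closure of [eventually] lets the preimages of all
    its subterms share one choice of Y, U, W. *)
Lemma eventually_incl (t : term S X) :
  eventually (fun Y U W => exists t0 : term (restrict U W) Y, incl t0 = t).
Proof.
elim: t => [x|g u IH|f x u IH].
- apply: eventually_mono (eventually_var x) => Y U W Yx.
  by exists (Var (exist _ x (mem_set Yx))).
- apply: eventually_mono (eventually_and (eventually_Fsym g) (eventually_all IH)).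
  move=> Y U W [Wg /choice [u0 hu]].
  exists (@Fterm (restrict U W) Y (exist _ g (mem_set Wg)) u0) => /=.
  by congr Fterm; apply: funext.
- have := eventually_and (eventually_Esym f)
    (eventually_and (eventually_var x) (eventually_all IH)).
  apply: eventually_mono => Y U W [Uf [Yx /choice [u0 hu]]].
  exists (@Eterm (restrict U W) Y (exist _ f (mem_set Uf))
    (exist _ x (mem_set Yx)) u0) => /=.
  by congr Eterm; apply: funext.
Qed.

Lemma eventually_hull_incl (w : hull S (term S X)) :
  eventually (fun Y U W =>
    exists w0 : hull (restrict U W) (term (restrict U W) Y),
      hull_incl (hull_map (incl (W:=W)) w0) = w).
Proof.
case: w => f a.
have := eventually_and (eventually_Esym f)
  (eventually_all (fun i => eventually_incl (a i))).
apply: eventually_mono => Y U W [Uf /choice [a0 ha]].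
exists (@hull_elt (restrict U W) _ (exist _ f (mem_set Uf)) a0).
by congr existT; apply: funext.
Qed.

End LocalParts.

(** * Gluing the local parts into one algebra on L *)

Section Table.
Variables (S : signature) (V : Type) (A : algebra S V) (X : Type) (v : X -> V).
Variables (I : set (hull S V)) (L : set (term S X)).
Hypothesis mL : model A v I L.
Let admL := model_admissible mL.

Section LocalModel.
Variables (Y : set X) (U : set (Esym S)) (W : set (Fsym S)).
Let L0 := local_part L (Y:=Y) (U:=U) (W:=W).
Let v0 (y : Y) := v (val y).
Let I0 : set (hull (restrict U W) V) := [set w | I (hull_incl w)].
Let incl_hull (w : hull (restrict U W) (term (restrict U W) Y)) :=
  hull_incl (hull_map (incl (W:=W)) w).

Lemma eval_incl (t : term (restrict U W) Y) :
  eval A v (incl t) = eval (reduct A U W) v0 t.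
Proof.
elim: t => [y|g u IH|f y u IH] //=.
- by congr fop; apply: funext.
- by congr sharp; apply: funext.
Qed.

Lemma local_model : model (reduct A U W) v0 I0 L0.
Proof.
split.
- move=> f a; split=> [g b y|g b].
    exact: (model_endo mL a).1.
  exact: (model_endo mL a).2.
- by move=> f a y; exact: (model_id mL).
- by move=> w z; exact: (@model_ideal _ _ _ _ _ _ _ mL (hull_incl w) (hull_incl z)).
- by move=> y; exact: (model_Var mL).
- by move=> g u; exact: (model_F mL).
- move=> f y u; rewrite /L0 /local_part /I0 /=.
  rewrite (_ : hull_incl _ =
    hull_elt (f := val f) (fun i => eval A v (incl (u i)))).
    exact: (model_E mL).
  by congr hull_elt; apply: funext => i; rewrite eval_incl.
Qed.

Lemma act_incl w t t' :
  act L0 w t t' -> act L (incl_hull w) (incl t) (incl t').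
Proof.
have nt z : nontrivial L0 z -> nontrivial L (incl_hull z).
  by move=> [y h]; exists (val y).
elim=> {w t t'}.
- move=> w t nw.
  (* A trivial w of the part can become nontrivial in L only when Y is empty; then t is built from
     symbols of F alone and is still fixed. *)
  have [nw'|] := pselect (nontrivial L (incl_hull w)); last exact: act_id.
  have Y0 (y : Y) : False by apply: nw; exists y; exact: (nontrivialP admL (val y) nw').
  elim: t => [y|g u IH|f y u _]; [by case: (Y0 y)| |by case: (Y0 y)].
  exact: act_F.
- by move=> w y nw; apply: act_Var; exact: nt.
- by move=> w g u u' nw _ IH; apply: act_F => //; exact: nt.
- move=> w f y u u' t nw _ IH _ IH'; apply: act_E; [exact: nt|exact: IH|exact: IH'].
Qed.

Lemma apply_incl w t : act_total L0 -> Omega L0 w -> L0 t ->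
  apply L (incl_hull w) (incl t) = incl (apply L0 w t).
Proof. by move=> tot ow lt; apply/applyE/act_incl/actP. Qed.

End LocalModel.

Hypothesis term_loc : forall (Y : set X) (U : set (Esym S)) (W : set (Fsym S)),
  finite_set Y -> finite_set U -> finite_set W ->
  terminating (reduct A U W) (fun y : Y => v (val y))
    [set w | I (hull_incl w)].

Lemma table_locally_operable : locally_operable L.
Proof.
move=> Y U W fY fU fW.
exact: (model_operable (local_model Y U W) (term_loc fY fU fW)).
Qed.

Lemma local_total (Y : set X) (U : set (Esym S)) (W : set (Fsym S)) :
  finite_set Y -> finite_set U -> finite_set W ->
  act_total (local_part L (Y:=Y) (U:=U) (W:=W)).
Proof.
by move=> fY fU fW; exact: (model_total (local_model Y U W) (term_loc fY fU fW)).
Qed.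

Lemma table_total : act_total L.
Proof.
move=> w t.
have [Y [U [W [fY fU fW [[w0 <-] [t0 <-]]]]]] := eventually_ex
  (eventually_and (eventually_hull_incl w) (eventually_incl t)).
move=> ow lt; exists (incl (apply (local_part L (W:=W)) w0 t0)).
by apply/act_incl/actP => //; exact: local_total.
Qed.
Let tot := table_total.

Lemma table_apply_apply w z t : Omega L w -> Omega L z -> L t ->
  apply L w (apply L z t) = apply L (mul_hull L w z) (apply L w t).
Proof.
have [Y [U [W [fY fU fW [[w0 <-] [[z0 <-] [t0 <-]]]]]]] := eventually_ex
  (eventually_and (eventually_hull_incl w)
    (eventually_and (eventually_hull_incl z) (eventually_incl t))).
move=> ow oz lt.
have tot0 := local_total fY fU fW.
have m0 := local_model Y U W.
rewrite !apply_incl //; last exact: (apply_in m0).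
rewrite (apply_apply m0 (term_loc fY fU fW)) //.
rewrite -apply_incl //; [|exact: (Omega_mul_hull m0)|exact: (apply_in m0)].
congr apply; congr hull_elt; apply: funext => i.
by rewrite /= -apply_incl //; exact: oz.
Qed.

Lemma Omega_val (f : Esym S) (a : 'I_(Ear f) -> L) :
  Omega L (hull_elt (fun i => val (a i))).
Proof. by move=> i; exact: set_valP. Qed.

Lemma Fterm_val (g : Fsym S) (a : 'I_(Far g) -> L) :
  L (Fterm g (fun i => val (a i))).
Proof. by apply/(model_F mL) => i; exact: set_valP. Qed.

Definition table : algebra S L :=
  @Algebra S L
    (fun f a l => exist _ (apply L (hull_elt (fun i => val (a i))) (val l))
       (mem_set (apply_in mL tot (@Omega_val f a) (set_valP l))))
    (fun g a => exist _ (Fterm g (fun i => val (a i)))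
       (mem_set (Fterm_val a))).

Lemma table_endomorphic : partially_endomorphic table.
Proof.
move=> f a; split=> [g b l|g b]; apply: val_inj => /=.
- by apply: table_apply_apply; [exact: Omega_val|exact: Omega_val|exact: set_valP].
- rewrite (apply_F tot) //; [exact: Omega_val|move=> i; exact: set_valP].
Qed.

Lemma table_pre_endomorphic : pre_endomorphic_Laver_table table.
Proof.
split=> //; first exact: table_locally_operable.
move=> Y U W fY fU fW w q rq a l t aE lE /=; rewrite lE.
have lt : local_part L t by rewrite /local_part /= -lE; exact: set_valP.
have /act_incl := ranked_act (model_admissible (local_model Y U W)) rq lt.
move=> /applyE <-; congr apply; congr hull_elt.
exact: funext.
Qed.

(** Arguments and symbol of any value of f^# lie in a finite part, which is operable and so
    prescribes that value. *)
Lemma table_unique (A' : algebra S L) :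
  pre_endomorphic_Laver_table A' -> A' = table.
Proof.
move=> [_ shA' fopA'].
have shE f a l : sharp A' (f:=f) a l = sharp table a l.
  apply: val_inj.
  have := eventually_and (@eventually_Esym S X f) (eventually_and
    (eventually_all (fun i => eventually_incl (val (a i))))
    (eventually_incl (val l))).
  move=> /eventually_ex [Y [U [W [fY fU fW [Uf [/choice [a0 ha] [t0 ht]]]]]]].
  pose w0 := @hull_elt (restrict U W) (term (restrict U W) Y)
    (exist _ f (mem_set Uf)) a0.
  have ow0 : Omega (local_part L (W:=W)) w0.
    by move=> i; rewrite /local_part /= ha; exact: set_valP.
  have [q rq] := (table_locally_operable fY fU fW).2 w0 ow0.
  have [_ shT _] := table_pre_endomorphic.
  rewrite (shA' _ _ _ fY fU fW w0 q rq a l t0) //.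
  by rewrite (shT _ _ _ fY fU fW w0 q rq a l t0).
have fopE g a : fop A' (g:=g) a = fop table a by apply: val_inj; exact: fopA'.
case: A' shE fopE {shA' fopA'} => sh fo /= shE fopE.
by congr Algebra; apply: functional_extensionality_dep => s;
  apply: funext => a; rewrite ?fopE //; apply: funext => l; rewrite shE.
Qed.

Lemma table_eval f a l :
  eval A v (val (sharp table (f:=f) a l)) =
  sharp A (fun i => eval A v (val (a i))) (eval A v (val l)).
Proof. by apply: (eval_apply mL tot); [exact: Omega_val|exact: set_valP]. Qed.

End Table.

(** * Li and self-distributivity of the hull *)

Section Hull.
Variables (S : signature) (V : Type) (A : algebra S V).

(** Equality of dependent pairs yields a transport along a proof of f = f, which proof irrelevance
    removes. *)
Lemma hull_elt_inj (f : Esym S) : injective (@hull_elt S V f).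
Proof.
move=> a b ab; have := projT2_eq ab.
by rewrite (Prop_irrelevance (projT1_eq ab) erefl).
Qed.

Lemma hull_mul_distr : partially_endomorphic A ->
  right_distributive (hull_mul A) (hull_mul A).
Proof.
move=> endo w z t; congr hull_elt; apply: funext => i.
exact: (endo _ _).1.
Qed.

(** Multiply the constant tuple (h, y, ..., y), for some h of positive arity, and read off
    coordinate 0. *)
Lemma Li_sharp (f : Esym S) a y : ~ degenerate S ->
  Li (hull_mul A) (@hull_elt S V f a) -> sharp A a y = y.
Proof.
move=> nd Lia.
have [h h0] : exists h : Esym S, 0 < Ear h.
  apply: contrapT => nh; apply: nd; split; first by exists f.
  by move=> h; apply/eqP; rewrite -leqn0 leqNgt; apply/negP => ?; apply: nh; exists h.
have /hull_elt_inj e := Lia (@hull_elt S V h (fun=> y)).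
exact: (congr1 (@^~ (Ordinal h0)) e).
Qed.

Lemma Li_degenerate w : degenerate S -> Li (hull_mul A) w.
Proof.
move=> [_ h0] [g b]; congr hull_elt; apply: funext => i.
by case: i => k lt_k; exfalso; rewrite h0 in lt_k.
Qed.

End Hull.

Lemma smallest_subuniverse (S : signature) (V : Type) (A : algebra S V)
  (G : set V) : subuniverse A (smallest (subuniverse A) G).
Proof.
split=> [f a y aG yG|g a aG] B /= [sB GB].
- apply: sB.1; first by move=> i; exact: aG.
  exact: yG.
- by apply: sB.2 => i; exact: aG.
Qed.

(** * Consequences of being locally Laver-like *)

Section LocallyLaverLike.
Variables (S : signature) (V : Type) (A : algebra S V).
Hypotheses (A_endo : partially_endomorphic A) (A_Laver : locally_Laver_like A).

(* In a finitely generated subalgebra the left powers of an idempotent are    *)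
(* constant.                                                                  *)
Lemma idempotent_Li w : hull_mul A w w = w -> Li (hull_mul A) w.
Proof.
case: w => f a ww [h b].
(* Li of a subalgebra tests only elements of its own hull, so a subalgebra is generated anew for
   each test element (h, b). *)
pose U := [set f; h].
pose G := range a `|` range b.
pose B := smallest (subuniverse (reduct A U set0)) G.
have clB : subuniverse (reduct A U set0) B := smallest_subuniverse _ _.
have [_ _ LB] : Laver_like_algebra (subalgebra clB).
  apply: A_Laver; rewrite /U ?finite_setU //; exists G => //.
  by rewrite finite_setU; split; exact: finite_image.
have aB i : B (a i) by move=> C /= [_]; apply; left; exists i.
have bB i : B (b i) by move=> C /= [_]; apply; right; exists i.
have Uf : U f by left.
have Uh : U h by right.
pose wB : hull (restrict U set0) B := @hull_elt (restrict U set0) B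
  (exist _ f (mem_set Uf)) (fun i => exist _ (a i) (mem_set (aB i))).
pose zB : hull (restrict U set0) B := @hull_elt (restrict U set0) B
  (exist _ h (mem_set Uh)) (fun i => exist _ (b i) (mem_set (bB i))).
have wwB : hull_mul (subalgebra clB) wB wB = wB.
  congr hull_elt; apply: funext => i; apply: val_inj => /=.
  exact: (congr1 (@^~ i) (hull_elt_inj ww)).
have [n] := LB (fun=> wB).
have -> : left_product (hull_mul (subalgebra clB)) (fun=> wB) n = wB.
  by elim: n => //= n ->.
move=> /(_ zB) wz.
exact: (congr1 (fun z => hull_incl (hull_map val z)) wz).
Qed.

(** The product is idempotent: (w * z) * (w * z) = w * (z * z) = w * z. *)
Lemma Li_ideal w z : Li (hull_mul A) z -> Li (hull_mul A) (hull_mul A w z).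
Proof. by move=> Lz; apply: idempotent_Li; rewrite -hull_mul_distr // Lz. Qed.

Lemma locally_terminating (X : Type) (v : X -> V) (Y : set X)
    (U : set (Esym S)) (W : set (Fsym S)) :
  finite_set Y -> finite_set U -> finite_set W ->
  terminating (reduct A U W) (fun y : Y => v (val y))
    [set w | Li (hull_mul A) (hull_incl w)].
Proof.
move=> fY fU fW z.
pose B := smallest (subuniverse (reduct A U W)) (v @` Y).
have clB : subuniverse (reduct A U W) B := smallest_subuniverse _ _.
have [_ _ LB] : Laver_like_algebra (subalgebra clB).
  by apply: A_Laver => //; exists (v @` Y) => //; exact: finite_image.
have evB t : B (eval (reduct A U W) (fun y : Y => v (val y)) t).
  elim: t => [y|g u IH|f y u IH] /=.
  - by move=> C /= [_]; apply; exists (val y) => //; exact: set_valP.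
  - exact: clB.2.
  - by apply: clB.1 => // C /= [_]; apply; exists (val y) => //; exact: set_valP.
pose evs t : B := exist _ (eval (reduct A U W) (fun y : Y => v (val y)) t)
  (mem_set (evB t)).
pose zB n : hull (restrict U W) B := hull_map evs (z n).
have pE n : left_product (hull_mul (reduct A U W))
    (fun n => hull_map (eval (reduct A U W) (fun y : Y => v (val y))) (z n)) n =
    hull_map val (left_product (hull_mul (subalgebra clB)) zB n).
  by elim: n => //= n ->.
(* The product is known to be in Li only for the subalgebra; this makes it idempotent, hence an
   element of Li of the whole hull. *)
have [n Lp] := LB zB; exists n; apply: idempotent_Li; rewrite pE.
exact: (congr1 (fun z => hull_incl (hull_map val z)) (Lp _)).
Qed.

Lemma Li_model (X : Type) (v : X -> V) : ~ degenerate S ->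
  model A v (Li (hull_mul A)) (domain A v).
Proof.
move=> nd; split=> //.
- by move=> f a y; exact: Li_sharp.
- exact: Li_ideal.
Qed.

End LocallyLaverLike.

(** * The degenerate case and the theorem *)

Definition unit_algebra (S : signature) : algebra S unit :=
  @Algebra S unit (fun _ _ _ => tt) (fun _ _ => tt).

(** Here Li is the whole hull, so L has no terms f_x, while the unary f^# on V may differ from the
    identity and violate [model_id]. Over a point this cannot happen, and [setT] describes the same
    L. *)
Lemma degenerate_model (S : signature) (V : Type) (A : algebra S V) (X : Type)
  (v : X -> V) : degenerate S ->
  model (unit_algebra S) (fun _ : X => tt) setT (domain A v).
Proof.
move=> d; split=> //.
- by move=> f a y _; case: y.
- move=> f x u; split=> [[_]|[_]]; last by case.
  by case; exact: Li_degenerate.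
Qed.

Theorem theorem5p10 (S : signature) (V : Type) (A : algebra S V)
    (A_endo : partially_endomorphic A) (A_Laver : locally_Laver_like A)
    (X : Type) (v : X -> V) :
  locally_operable (domain A v) /\
  (exists LA : algebra S (domain A v),
     unique (pre_endomorphic_Laver_table (L:=domain A v)) LA /\
     (~ degenerate S -> homomorphism LA A (phi (A:=A) (v:=v))) /\
     partially_endomorphic_Laver_table LA) /\
  (Laver_like_algebra A -> operable (domain A v)).
Proof.
have [d|nd] := pselect (degenerate S).
  have m := degenerate_model A v d.
  have t0 (Y : set X) (U : set (Esym S)) (W : set (Fsym S)) :
      finite_set Y -> finite_set U -> finite_set W ->
      terminating (reduct (unit_algebra S) U W) (fun y : Y => tt)
        [set w | setT (hull_incl w)].
    by move=> _ _ _ z; exists 0.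
  split; first exact: (table_locally_operable m t0).
  split; last by move=> _; apply: (model_operable m) => z; exists 0.
  exists (table m t0); split; [split|split=> //; split].
  - exact: table_pre_endomorphic.
  - by move=> A' /(table_unique m t0).
  - exact: table_pre_endomorphic.
  - exact: table_endomorphic.
have m := Li_model A_endo A_Laver v nd.
have t0 := locally_terminating A_Laver v.
split; first exact: (table_locally_operable m t0).
split; last first.
  by move=> [_ _ LA]; apply: (model_operable m) => z; exact: LA.
exists (table m t0); split; [split|split; [move=> _; split|split]].
- exact: table_pre_endomorphic.
- by move=> A' /(table_unique m t0).
- by move=> f a y; exact: table_eval.
- by [].
- exact: table_pre_endomorphic.
- exact: table_endomorphic.
Qed.
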